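(* Let $Q_{2^{\infty}}$ be the locally quaternion group and $D_{2^{\infty}}$ the locally dihedral group. Then the power graph $\mathrm{Pow}(Q_{2^{\infty}})$ is isomorphic (as a graph) to the commuting graph $\mathrm{Com}(D_{2^{\infty}})$.
   Context: All graphs are undirected and simple. For a group $G$, $\mathrm{Pow}(G)$ is the graph with vertex set $G$ in which two distinct vertices are adjacent if one is an (integer) power of the other; $\mathrm{Com}(G)$ is the graph with vertex set $G$ in which two distinct vertices $x,y$ are adjacent if $xy=yx$. $C_{2^\infty}$ denotes the Prüfer 2-group, $C_{2^{\infty}} = \langle g_1,g_2,g_3,\ldots \mid g_1^2=1,\ g_2^2=g_1,\ g_3^2=g_2,\ldots\rangle$, which is the union of a chain of cyclic groups of orders $2,2^2,2^3,\ldots$. The locally quaternion group $Q_{2^\infty}$ (the union of the chain of generalised quaternion groups $Q_8\subseteq Q_{16}\subseteq Q_{32}\subseteq\cdots$) has the presentation $$Q_{2^{\infty}} = \langle C,x \mid C\cong C_{2^\infty},\ x^{-1}cx=c^{-1}\text{ for every } c\in C,\ x^2=z\rangle,$$ where $z$ is the unique element of order 2 of $C$. It is the disjoint union of the cosets $C$ and $Cx$. The locally dihedral group $D_{2^\infty}$ (the union of the chain of dihedral groups of orders $8,16,32,\ldots$) has the presentation $$D_{2^{\infty}} = \langle C,s \mid C\cong C_{2^\infty},\ s^2=1,\ scs=c^{-1}\text{ for every } c\in C\rangle,$$ i.e. it is the semidirect product $C\rtimes\langle s\rangle$ with $s$ of order 2 acting by inversion. *)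

(* Defs.v *)
From HB Require Import structures.
From mathcomp Require Import all_boot.
From mathcomp Require Import generic_quotient boolp.

Set Implicit Arguments.
Unset Strict Implicit.
Unset Printing Implicit Defensive.

Local Open Scope group_scope.

Record simple_graph := SimpleGraph {
  vertex :> Type;
  adj : vertex -> vertex -> Prop;
  adj_sym : forall x y, adj x y -> adj y x;
  adj_irrefl : forall x, ~ adj x x }.

Definition graph_isomorphic (S T : simple_graph) : Prop :=
  exists f : S -> T, bijective f /\ forall x y, adj x y <-> adj (f x) (f y).

(* The exponent ranges over the integers: [x ^- n] is [(x ^+ n)^-1]. *)
Definition is_power_of (G : groupType) (y x : G) : Prop :=
  exists n : nat, y = x ^+ n \/ y = x ^- n.

Definition pow_adj (G : groupType) (x y : G) : Prop :=
  x <> y /\ (is_power_of x y \/ is_power_of y x).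

Definition com_adj (G : groupType) (x y : G) : Prop :=
  x <> y /\ x * y = y * x.

Lemma pow_adj_sym (G : groupType) (x y : G) : pow_adj x y -> pow_adj y x.
Proof. by case=> nxy pxy; split; [exact: nesym | case: pxy; [right | left]]. Qed.

Lemma pow_adj_irrefl (G : groupType) (x : G) : ~ pow_adj x x.
Proof. by case. Qed.

Lemma com_adj_sym (G : groupType) (x y : G) : com_adj x y -> com_adj y x.
Proof. by case=> nxy cxy; split; [exact: nesym | exact: esym]. Qed.

Lemma com_adj_irrefl (G : groupType) (x : G) : ~ com_adj x x.
Proof. by case. Qed.

Definition Pow (G : groupType) : simple_graph :=
  SimpleGraph (@pow_adj_sym G) (@pow_adj_irrefl G).

Definition Com (G : groupType) : simple_graph :=
  SimpleGraph (@com_adj_sym G) (@com_adj_irrefl G).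

(* The letter [(x, false)] stands for the generator [x] and [(x, true)] for
   its formal inverse; multiplication of words is concatenation. *)
Definition word (X : choiceType) : Type := seq (X * bool).

HB.instance Definition _ (X : choiceType) := Choice.on (word X).

Definition gen (X : choiceType) (x : X) : word X := [:: (x, false)].

Definition word_inv (X : choiceType) (w : word X) : word X :=
  rev [seq (l.1, ~~ l.2) | l <- w].

(* The congruence on words generated by free cancellation and by the defining
   relations [u = v], given as the pairs with [rels u v]. *)
Inductive word_congr (X : choiceType) (rels : word X -> word X -> Prop) :
    word X -> word X -> Prop :=
| word_congr_rel u v : rels u v -> word_congr rels u v
| word_congr_cancel x b : word_congr rels [:: (x, b); (x, ~~ b)] [::]
| word_congr_cat u u' v v' :
    word_congr rels u u' -> word_congr rels v v' ->
    word_congr rels (u ++ v) (u' ++ v')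
| word_congr_refl u : word_congr rels u u
| word_congr_sym u v : word_congr rels u v -> word_congr rels v u
| word_congr_trans u v w :
    word_congr rels u v -> word_congr rels v w -> word_congr rels u w.

Section Presentation.
Variables (X : choiceType) (rels : word X -> word X -> Prop).

Definition word_eqv (u v : word X) : bool := `[< word_congr rels u v >].

Lemma word_eqv_equiv : equiv_class_of word_eqv.
Proof.
split=> [u | u v | v u w].
- exact/asboolP/word_congr_refl.
- by apply/asboolP/asboolP => /word_congr_sym.
- move=> /asboolP uv /asboolP vw; apply/asboolP.
  exact: word_congr_trans uv vw.
Qed.

Canonical word_eqv_equivRel := EquivRelPack word_eqv_equiv.

Definition presented : Type := {eq_quot word_eqv}%qT.

HB.instance Definition _ := Choice.on presented.
HB.instance Definition _ := EqQuotient.on presented.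

Definition word_class (u : word X) : presented := (\pi_presented u)%qT.

Lemma word_classP u v : word_class u = word_class v <-> word_congr rels u v.
Proof.
split=> [/eqquotP/asboolP // | uv].
by apply/eqquotP/asboolP.
Qed.

Lemma word_class_repr (a : presented) : word_class (repr a) = a.
Proof. exact: reprK. Qed.

Definition presented_mul (a b : presented) : presented :=
  word_class (repr a ++ repr b).
Definition presented_inv (a : presented) : presented :=
  word_class (word_inv (repr a)).
Definition presented_one : presented := word_class [::].

Lemma repr_word_class u : word_congr rels (repr (word_class u)) u.
Proof. by apply/word_classP; rewrite word_class_repr. Qed.

Lemma presented_mulE u v :
  presented_mul (word_class u) (word_class v) = word_class (u ++ v).
Proof. by apply/word_classP/word_congr_cat; exact: repr_word_class. Qed.

Lemma word_inv_cons (l : X * bool) (u : word X) :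
  word_inv (l :: u) = word_inv u ++ [:: (l.1, ~~ l.2)].
Proof. by rewrite /word_inv /= rev_cons cats1. Qed.

Lemma word_inv_involutive : involutive (@word_inv X).
Proof.
move=> u; rewrite /word_inv map_rev revK -map_comp -[RHS]map_id.
by apply: eq_map => -[x b] /=; rewrite negbK.
Qed.

Lemma word_congr_mulV u : word_congr rels (u ++ word_inv u) [::].
Proof.
elim: u => [|[x b] u IHu]; first exact: word_congr_refl.
rewrite word_inv_cons /= -cat1s catA.
apply: word_congr_trans (word_congr_cancel rels x b).
rewrite -[[:: (x, b); _]]/([:: (x, b)] ++ ([::] ++ [:: (x, ~~ b)])) -catA.
apply: word_congr_cat; first exact: word_congr_refl.
rewrite catA; apply: word_congr_cat IHu _; exact: word_congr_refl.
Qed.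

Lemma presented_mulA : associative presented_mul.
Proof.
move=> a b c.
rewrite -(word_class_repr a) -(word_class_repr b) -(word_class_repr c).
by rewrite !presented_mulE catA.
Qed.

Lemma presented_mul1 : left_id presented_one presented_mul.
Proof. by move=> a; rewrite -(word_class_repr a) presented_mulE. Qed.

Lemma presented_mulr1 : right_id presented_one presented_mul.
Proof. by move=> a; rewrite -(word_class_repr a) presented_mulE cats0. Qed.

Lemma presented_mulV :
  right_inverse presented_one presented_inv presented_mul.
Proof.
move=> a; rewrite -{1}(word_class_repr a) /presented_inv presented_mulE.
exact/word_classP/word_congr_mulV.
Qed.

Lemma presented_mulVr :
  left_inverse presented_one presented_inv presented_mul.
Proof.
move=> a; rewrite -{2}(word_class_repr a) /presented_inv presented_mulE.
apply/word_classP; rewrite -{2}[repr a]word_inv_involutive.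
exact: word_congr_mulV.
Qed.

HB.instance Definition _ := isGroup.Build presented
  presented_mulA presented_mul1 presented_mulr1
  presented_mulVr presented_mulV.

End Presentation.

(* The Pruefer 2-group; the generator [n : nat] stands for g_{n+1}. *)
Inductive prufer_rel : word nat -> word nat -> Prop :=
| prufer_rel0 : prufer_rel (gen 0%N ++ gen 0%N) [::]
| prufer_relS n : prufer_rel (gen n.+1 ++ gen n.+1) (gen n).

Definition prufer2 : groupType := presented prufer_rel.

(* The generators are the elements of C = [prufer2], as [Some c], together with
   one further generator, [None], which is x in the quaternion case and s in
   the dihedral case. C itself is presented by its multiplication table. The
   hypotheses of [quaternion_rel_sqr] say that z has order 2; C has exactly one
   such element. *)

Inductive quaternion_rel :
    word (option prufer2) -> word (option prufer2) -> Prop :=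
| quaternion_rel_mul (c d : prufer2) :
    quaternion_rel (gen (Some c) ++ gen (Some d)) (gen (Some (c * d)))
| quaternion_rel_conj (c : prufer2) :
    quaternion_rel (word_inv (gen None) ++ gen (Some c) ++ gen None)
                   (gen (Some c^-1))
| quaternion_rel_sqr (z : prufer2) : z <> 1 -> z ^+ 2 = 1 ->
    quaternion_rel (gen None ++ gen None) (gen (Some z)).

Definition locally_quaternion : groupType := presented quaternion_rel.

Inductive dihedral_rel :
    word (option prufer2) -> word (option prufer2) -> Prop :=
| dihedral_rel_mul (c d : prufer2) :
    dihedral_rel (gen (Some c) ++ gen (Some d)) (gen (Some (c * d)))
| dihedral_rel_sqr : dihedral_rel (gen None ++ gen None) [::]
| dihedral_rel_conj (c : prufer2) :
    dihedral_rel (gen None ++ gen (Some c) ++ gen None) (gen (Some c^-1)).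

Definition locally_dihedral : groupType := presented dihedral_rel.

(* Main.v *)
(* Both groups consist of the elements c and c y with c in C, where y inverts C
   and y^2 = z, resp. y^2 = 1; the isomorphism maps c to c and c y to c y. In
   either graph C is a clique, since C is abelian and any two of its elements
   are comparable for "is a power of". In Q the powers of c y are 1, z, c y and
   z c y. In D the element c y commutes with d iff d^2 = 1, and with d y iff
   (c d^-1)^2 = 1. As z is the only involution of C, the two graphs agree. *)
Require Import Defs.
From mathcomp Require Import all_boot.
From mathcomp Require Import all_algebra all_field.

Set Implicit Arguments.
Unset Strict Implicit.
Unset Printing Implicit Defensive.

Import GRing.Theory Num.Theory.
Local Open Scope group_scope.

(** * Actions of words, and induction in presented groups *)

Definition word_act (X : choiceType) (T : Type) (f : X * bool -> T -> T)
  (w : word X) (t : T) : T := foldr f t w.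

(** This separates elements of a presented group: words that move some point differently cannot be
    congruent. Free cancellation is respected by the first hypothesis, the defining relations by the
    second. *)
Lemma word_act_congr (X : choiceType) (T : Type) (f : X * bool -> T -> T)
    (rels : word X -> word X -> Prop) :
  (forall x b, cancel (f (x, ~~ b)) (f (x, b))) ->
  (forall u v, rels u v -> word_act f u =1 word_act f v) ->
  forall u v, word_congr rels u v -> word_act f u =1 word_act f v.
Proof.
move=> fK f_rels u v; elim=> {u v} //=.
- move=> u u' v v' _ IHu _ IHv t.
  by rewrite /word_act !foldr_cat -/(word_act f v t) IHv; exact: IHu.
- by move=> u v _ IH t; rewrite IH.
- by move=> u v w _ IHu _ IHv t; rewrite IHu.
Qed.

Section Presented.
Variables (X : choiceType) (rels : word X -> word X -> Prop).
Implicit Types (u v : word X) (a : presented rels).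

Lemma word_class_cat u v :
  word_class rels (u ++ v) = word_class rels u * word_class rels v.
Proof. exact/esym/presented_mulE. Qed.

Lemma word_class_inv u :
  word_class rels (word_inv u) = (word_class rels u)^-1.
Proof.
apply/esym/mulg1_eq; rewrite -word_class_cat.
exact/word_classP/word_congr_mulV.
Qed.

Lemma word_class_rel u v : rels u v -> word_class rels u = word_class rels v.
Proof. by move=> uv; apply/word_classP/word_congr_rel. Qed.

Lemma presented_ind (P : presented rels -> Prop) :
  P 1 ->
  (forall x a, P a -> P (word_class rels (gen x) * a)) ->
  (forall x a, P a -> P ((word_class rels (gen x))^-1 * a)) ->
  forall a, P a.
Proof.
move=> P1 Pg PV a; rewrite -(word_class_repr a).
elim: (repr a) => [|[x b] u IHu] //.
rewrite -cat1s word_class_cat; case: b; last exact: Pg.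
by rewrite -[[:: (x, true)]]/(word_inv (gen x)) word_class_inv; exact: PV.
Qed.

End Presented.

Lemma expg_gcd_order (G : groupType) (x : G) N i j :
  0 < N -> x ^+ N = 1 -> gcdn i N %| j -> exists k, x ^+ j = x ^+ i ^+ k.
Proof.
move=> N_gt0 xN /dvdnP[q ->].
(* Here [N] divides [gcdn i N + a * i], so the gcd is [- a * i] modulo [N]; the sign is removed
   below by using [N.-1] as exponent for the inverse. *)
have [a _ /dvdnP[r Dr]] := Bezoutr i N_gt0.
have xi : x ^+ gcdn i N = (x ^+ i ^+ a)^-1.
  apply/esym/mulg1_eq.
  by rewrite -expgnA -expgnDr addnC (mulnC i) Dr mulnC expgnA xN expg1n.
have xiN : x ^+ i ^+ N = 1 by rewrite -expgnA mulnC expgnA xN expg1n.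
have xiV : (x ^+ i)^-1 = x ^+ i ^+ N.-1.
  by apply: mulg1_eq; rewrite -expgS prednK.
exists (N.-1 * a * q)%N.
by rewrite mulnC expgnA xi -expVgn xiV -!expgnA !mulnA.
Qed.

(** * The Prüfer group: a chain of cyclic 2-groups with one involution *)

Section Pruefer.

Let g (n : nat) : prufer2 := word_class prufer_rel (gen n).

Lemma prufer_gen_pow n k : g n = g (n + k) ^+ (2 ^ k).
Proof.
elim: k => [|k IHk]; first by rewrite addn0.
rewrite IHk addnS expnS expgnA; congr (_ ^+ _).
by rewrite expg2 /g -word_class_cat -(word_class_rel (prufer_relS _)).
Qed.

Lemma prufer_gen_order n : g n ^+ (2 ^ n.+1) = 1.
Proof.
rewrite expnSr expgnA -[X in g X]add0n -prufer_gen_pow.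
by rewrite expg2 /g -word_class_cat (word_class_rel prufer_rel0).
Qed.

Lemma prufer_gen_leq n m i : n <= m -> exists j, g n ^+ i = g m ^+ j.
Proof.
move=> /subnKC <-; exists (2 ^ (m - n) * i)%N.
by rewrite expgnA -prufer_gen_pow.
Qed.

Lemma prufer_genV n : (g n)^-1 = g n ^+ (2 ^ n.+1).-1.
Proof.
by apply: mulg1_eq; rewrite -expgS prednK ?expn_gt0 // prufer_gen_order.
Qed.

(** The cyclic groups of the generators form a chain, so a product can be moved into the one of
    larger index; inverses are positive powers because the generators have finite order. *)
Lemma prufer_pow_gen (a : prufer2) : exists n k, a = g n ^+ k.
Proof.
have mulP x i b : (exists n k, b = g n ^+ k) ->
    exists n k, g x ^+ i * b = g n ^+ k.
  move=> [n [k ->]]; exists (maxn x n).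
  have [j1 ->] := prufer_gen_leq i (leq_maxl x n).
  have [j2 ->] := prufer_gen_leq k (leq_maxr x n).
  by exists (j1 + j2)%N; rewrite expgnDr.
elim/presented_ind: a => [|x b|x b]; first by exists 0%N, 0%N.
  exact: (mulP x 1%N).
by move=> IHb; rewrite -/(g x) prufer_genV; exact: mulP.
Qed.

Lemma prufer_pow_gen2 (a b : prufer2) :
  exists n i j, a = g n ^+ i /\ b = g n ^+ j.
Proof.
have [m [i ->]] := prufer_pow_gen a; have [n [j ->]] := prufer_pow_gen b.
have [i' ->] := prufer_gen_leq i (leq_maxl m n).
have [j' ->] := prufer_gen_leq j (leq_maxr m n).
by exists (maxn m n), i', j'.
Qed.

Lemma prufer_mulC : @commutative prufer2 _ *%g.
Proof.
move=> a b; have [n [i [j [-> ->]]]] := prufer_pow_gen2 a b.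
by rewrite -!expgnDr addnC.
Qed.

(** In a cyclic group of 2-power order the gcds of the two exponents with [2 ^ n.+1] are powers of
    2, so one divides the other. *)
Lemma prufer_comparable (a b : prufer2) :
  (exists k, b = a ^+ k) \/ (exists k, a = b ^+ k).
Proof.
have [n [i [j [-> ->]]]] := prufer_pow_gen2 a b.
have N_gt0 : 0 < 2 ^ n.+1 by rewrite expn_gt0.
have gN := prufer_gen_order n.
have /(dvdn_pfactor _ _ (isT : prime 2))[r _ Dr] := dvdn_gcdr i (2 ^ n.+1).
have /(dvdn_pfactor _ _ (isT : prime 2))[s _ Ds] := dvdn_gcdr j (2 ^ n.+1).
have [/(dvdn_exp2l 2)|/ltnW/(dvdn_exp2l 2)] := leqP r s;
  rewrite -Dr -Ds => d_ij.
  by left; apply: expg_gcd_order gN _; rewrite // (dvdn_trans d_ij) ?dvdn_gcdl.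
by right; apply: expg_gcd_order gN _; rewrite // (dvdn_trans d_ij) ?dvdn_gcdl.
Qed.

Definition prufer_z : prufer2 := g 0.

Lemma prufer_z_sq : prufer_z * prufer_z = 1.
Proof. by rewrite -expg2 -(prufer_gen_order 0). Qed.

(* C acts on the algebraic complex numbers, with g_n acting as multiplication
   by a primitive 2^n-th root of unity. *)
Lemma prufer_z_neq1 : prufer_z <> 1.
Proof.
pose r n : algC := iter n sqrtC (- 1)%R.
have r_sq n : (r n.+1 * r n.+1)%R = r n by rewrite -expr2 sqrtCK.
have r_neq0 n : (r n != 0)%R.
  elim: n => [|n]; first by rewrite oppr_eq0 oner_eq0.
  by apply: contra_neq => r0; rewrite -r_sq r0 mul0r.
pose f (l : nat * bool) (t : algC) : algC :=
  (if l.2 then (r l.1)^-1 * t else r l.1 * t)%R.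
have fK x b : cancel (f (x, ~~ b)) (f (x, b)).
  by case: b => t; rewrite /f /= ?mulVKf ?mulKf.
move=> /word_classP/(word_act_congr fK) h.
have /h/(_ 1%R)/eqP : forall u v, prufer_rel u v ->
    word_act f u =1 word_act f v.
  move=> u v [|n] t; rewrite /word_act /= /f /=.
    by rewrite /r /= !mulN1r opprK.
  by rewrite mulrA r_sq.
by rewrite /word_act /f /= mulr1 eq_sym -subr_eq0 opprK paddr_eq0 ?ler01 //
  oner_eq0.
Qed.

(** One of [w] and [z] is a power of the other, and an element of square 1 has only 1 and itself as
    powers. *)
Lemma prufer_z_uniq (w : prufer2) : w * w = 1 -> w = 1 \/ w = prufer_z.
Proof.
have pow2 (a : prufer2) k : a * a = 1 -> a ^+ k = 1 \/ a ^+ k = a.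
  move=> aa; elim: k => [|k [IH|IH]]; first by left.
    by right; rewrite expgS IH mulg1.
  by left; rewrite expgS IH.
move=> ww; have [[k Dz]|[k ->]] := prufer_comparable w prufer_z.
  have [wk1|wk] := pow2 w k ww; last by right; rewrite Dz.
  by case: prufer_z_neq1; rewrite Dz.
exact/pow2/prufer_z_sq.
Qed.

End Pruefer.

(** * Normal forms in extensions by an inverting element *)

(* [(c, e)] stands for c y^e, where y inverts the abelian group C and y^2 = z. *)
Definition ext_mul (C : groupType) (z : C) (p q : C * bool) : C * bool :=
  (p.1 * (if p.2 then q.1^-1 else q.1) * (if p.2 && q.2 then z else 1),
   p.2 (+) q.2).

Definition is_inversion_ext (C : groupType) (z : C) (G : groupType)
    (nf : C * bool -> G) : Prop :=
  bijective nf /\ forall p q, nf p * nf q = nf (ext_mul z p q).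

Section PresentedInversionExt.
Variables (C : groupType) (z : C).
Hypotheses (mulC : @commutative C _ *%g) (zz : z * z = 1).

Let zV : z^-1 = z. Proof. exact: mulg1_eq. Qed.

(** The inverse of y is z y, since y^2 = z and z^2 = 1. *)
Definition ext_letter (l : option C * bool) : C * bool :=
  match l with
  | (Some c, b) => (if b then c^-1 else c, false)
  | (None, b) => (if b then z else 1, true)
  end.

Definition ext_act (l : option C * bool) : C * bool -> C * bool :=
  ext_mul z (ext_letter l).

Lemma ext_actK x b : cancel (ext_act (x, ~~ b)) (ext_act (x, b)).
Proof.
move=> [d e]; rewrite /ext_act /ext_mul; congr (_, _);
  last by case: x b e => [?|] [] [].
case: x b e => [c|] [] [] /=; rewrite ?mulg1 ?mul1g ?mulKg ?mulVKg //.
- by rewrite invgM invgK mulVKg.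
- by rewrite invgK mulC mulgA zz mul1g.
- by rewrite (mulC _ z) mulgA zz mul1g invgK.
by rewrite invgM invgK mulgVK.
Qed.

Lemma ext_act_mul c d p :
  ext_act (Some c, false) (ext_act (Some d, false) p) =
  ext_act (Some (c * d), false) p.
Proof. by rewrite /ext_act /ext_mul /= !mulg1 mulgA. Qed.

Lemma ext_act_conj c p :
  ext_act (None, true) (ext_act (Some c, false) (ext_act (None, false) p)) =
  ext_act (Some c^-1, false) p.
Proof.
case: p => d []; rewrite /ext_act /ext_mul /= !mul1g !mulg1.
  by rewrite !invgM invgK zV !mulgA zz mul1g mulC.
by rewrite invgM invgK mulC mulgA zz mul1g mulC.
Qed.

Lemma ext_act_sqr p :
  ext_act (None, false) (ext_act (None, false) p) = ext_act (Some z, false) p.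
Proof.
case: p => d []; rewrite /ext_act /ext_mul /= !mul1g !mulg1.
  by rewrite invgM invgK zV.
by rewrite invgK mulC.
Qed.

Variable rels : word (option C) -> word (option C) -> Prop.
Hypothesis rels_act :
  forall u v, rels u v -> word_act ext_act u =1 word_act ext_act v.

Let iota (c : C) : presented rels := word_class rels (gen (Some c)).
Let y : presented rels := word_class rels (gen None).

Hypotheses (iotaM : {morph iota : c d / c * d})
  (iota_y : forall c, iota c * y = y * iota c^-1) (yy : y * y = iota z).

Definition ext_nf (p : C * bool) : presented rels :=
  word_class rels (gen (Some p.1) ++ (if p.2 then gen None else [::])).

Lemma ext_nfE p : ext_nf p = iota p.1 * (if p.2 then y else 1).
Proof. by rewrite /ext_nf word_class_cat; case: p.2. Qed.

Lemma ext_nf_mul p q : ext_nf p * ext_nf q = ext_nf (ext_mul z p q).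
Proof.
have iota1 : iota 1 = 1 by apply: (@mulgI _ (iota 1)); rewrite -iotaM !mulg1.
have y_iota c : y * iota c = iota c^-1 * y by rewrite iota_y invgK.
case: p q => [c []] [d []]; rewrite !ext_nfE /= !mulg1 ?iotaM ?mulgA //.
- by rewrite -(mulgA _ y) y_iota !mulgA -(mulgA _ y) yy.
- by rewrite -(mulgA _ y) y_iota !mulgA.
Qed.

(** Normal forms are closed under products and include all generators and their inverses. *)
Lemma ext_nf_surj a : exists p, a = ext_nf p.
Proof.
have iota1 : iota 1 = 1 by apply: (@mulgI _ (iota 1)); rewrite -iotaM !mulg1.
have iotaE c : iota c = ext_nf (c, false) by rewrite ext_nfE mulg1.
have yE : y = ext_nf (1, true) by rewrite ext_nfE iota1 mul1g.
have genE l : exists p, word_class rels (gen l) = ext_nf p.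
  by case: l => [c|]; [exists (c, false) | exists (1, true)].
have genVE l : exists p, (word_class rels (gen l))^-1 = ext_nf p.
  case: l => [c|]; [exists (c^-1, false) | exists (z, true)]; apply: mulg1_eq.
    by rewrite -iotaE -iotaM mulgV.
  by rewrite -/y yE ext_nf_mul /ext_mul /= mul1g mulVg -iotaE.
elim/presented_ind: a => [|l a [q ->]|l a [q ->]].
- by exists (1, false); rewrite -iotaE.
- by have [p ->] := genE l; rewrite ext_nf_mul; exists (ext_mul z p q).
by have [p ->] := genVE l; rewrite ext_nf_mul; exists (ext_mul z p q).
Qed.

(** Injectivity comes from the action on pairs: the word of a normal form sends [(1, false)] to its
    own coordinates, and so does any congruent word, in particular the chosen representative. *)
Lemma presented_inversion_ext : is_inversion_ext z ext_nf.
Proof.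
split; last exact: ext_nf_mul.
pose coord (a : presented rels) := word_act ext_act (repr a) (1, false).
have nfK : cancel ext_nf coord.
  move=> [c e]; rewrite /coord.
  rewrite (word_act_congr ext_actK rels_act (repr_word_class _ _)).
  by case: e; rewrite /word_act /= /ext_act /ext_mul /= ?invg1 ?mulg1.
by exists coord => // a; have [p ->] := ext_nf_surj a; rewrite nfK.
Qed.

End PresentedInversionExt.

(** * Both graphs in coordinates *)

Section CosetRel.
Variables (C : groupType) (z : C).
Hypotheses (mulC : @commutative C _ *%g) (zz : z * z = 1).
Hypothesis z_uniq : forall w : C, w * w = 1 -> w = 1 \/ w = z.

(** The common description of equality or adjacency in the two graphs. The involution [z] appears in
    it even for the dihedral group, whose extension parameter is 1. *)
Definition coset_rel (p q : C * bool) : Prop :=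
  match p, q with
  | (c, true), (d, true) => c = d \/ c = z * d
  | (c, true), (d, false) | (d, false), (c, true) => d = 1 \/ d = z
  | (_, false), (_, false) => True
  end.

Let zV : z^-1 = z. Proof. exact: mulg1_eq. Qed.

Lemma com_coset_rel (G : groupType) (nf : C * bool -> G) p q :
  is_inversion_ext 1 nf -> (nf p * nf q = nf q * nf p <-> coset_rel p q).
Proof.
move=> [/bij_inj nf_inj nfM]; rewrite !nfM.
have z_sq (d : C) : d = 1 \/ d = z -> d^-1 = d by case=> ->; rewrite ?invg1.
have sq_z (d : C) : d^-1 = d -> d = 1 \/ d = z.
  by move=> dV; apply: z_uniq; rewrite -{1}dV mulVg.
(* The two sides on the right are the C-coordinates of (c y) d and d (c y). *)
have D (c d : C) : d^-1 = d <-> c * d^-1 = d * c.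
  by rewrite (mulC d); split=> [->|/mulgI].
split=> [/nf_inj|pq].
- case: p q => [c []] [d []] //= []; rewrite !mulg1.
  + move=> cd; suff [/divg1_eq|] : c / d = 1 \/ c / d = z; first by left.
      by move=> <-; right; rewrite mulgVK.
    by apply: sq_z; rewrite invgF cd.
  + by move=> /D/sq_z.
  + by move/esym/D/sq_z.
- congr nf; case: p q pq => [c []] [d []] //= pq; congr (_, _); rewrite /= ?mulg1.
  + case: pq => -> //.
    by rewrite mulgK invgM mulVKg zV.
  + exact/D/z_sq.
  + exact/esym/D/z_sq.
  + exact: mulC.
Qed.

Hypothesis comparableC :
  forall a b : C, (exists k, b = a ^+ k) \/ (exists k, a = b ^+ k).

Lemma pow_coset_rel (G : groupType) (nf : C * bool -> G) p q :
  is_inversion_ext z nf ->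
  (is_power_of (nf p) (nf q) \/ is_power_of (nf q) (nf p) <-> coset_rel p q).
Proof.
move=> [/bij_inj nf_inj nfM].
have nf1 : nf (1, false) = 1.
  by apply: (@mulgI _ (nf (1, false))); rewrite nfM /ext_mul /= !mulg1.
have nfX (c : C) n : nf (c, false) ^+ n = nf (c ^+ n, false).
  by elim: n => // n IHn; rewrite !expgS IHn nfM /ext_mul /= mulg1.
have nfV (c : C) : (nf (c, false))^-1 = nf (c^-1, false).
  by apply: mulg1_eq; rewrite nfM /ext_mul /= mulg1 mulgV.
have nfVt (c : C) : (nf (c, true))^-1 = nf (z * c, true).
  apply: mulg1_eq; rewrite nfM /ext_mul /= -nf1; congr (nf (_, _)).
  by rewrite invgM zV mulgA mulgV mul1g.
have powC c r : is_power_of r (nf (c, false)) -> exists d, r = nf (d, false).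
  by move=> [n [->|->]]; rewrite nfX ?nfV; eexists.
have powP c r : is_power_of (nf r) (nf (c, true)) <-> coset_rel (c, true) r.
  split.
    (* The four elements related to c y are stable under left multiplication by c y, hence contain
       all its natural powers. *)
    have step n : exists2 r, nf (c, true) ^+ n = nf r & coset_rel (c, true) r.
      elim: n => [|n [s IHn cs]]; first by exists (1, false) => //=; left.
      exists (ext_mul z (c, true) s); first by rewrite expgS IHn nfM.
      case: s cs {IHn} => d [] [] -> /=; rewrite ?mulgV ?mul1g ?mulg1 ?invg1.
      + by right.
      + by left; rewrite mulgK.
      + by left; rewrite mulg1.
      + by right; rewrite mulC mulgVK.
    move=> [n [|]]; have [s -> cs] := step n; first by move/nf_inj ->.
    case: s cs => d [] cs; rewrite ?nfVt ?nfV => /nf_inj ->.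
    + case: cs => ->; first by right; rewrite mulgA zz mul1g.
      by left.
    + by case: cs => ->; rewrite ?invg1 ?zV; [left | right].
  have sq : nf (c, true) * nf (c, true) = nf (z, false).
    by rewrite nfM /ext_mul /= mulgV mul1g.
  (* The exponents 1, -1, 0 and 2 produce c y, z c y, 1 and z. *)
  case: r => d [] [].
  + by move=> ->; exists 1%N; left.
  + by move=> ->; exists 1%N; right; rewrite expg1 nfVt mulgA zz mul1g.
  + by move=> ->; exists 0%N; left; rewrite nf1.
  + by move=> ->; exists 2%N; left; rewrite expg2 sq.
(* Powers of elements of C stay in C, so across the two cosets only one direction is possible. *)
have nopow c d : ~ is_power_of (nf (c, true)) (nf (d, false)).
  by move/powC => [e /nf_inj].
case: p q => [c []] [d []].
- rewrite !powP /=; split; last by right.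
  case=> //; case=> ->; first by left.
  by right; rewrite mulgA zz mul1g.
- by rewrite powP; split=> [[/nopow|]|]; [| |right].
- by rewrite powP; split=> [[|/nopow]|]; [| |left].
split=> // _; have [[k ->]|[k ->]] := comparableC c d; [right | left];
  by exists k; left; rewrite nfX.
Qed.

End CosetRel.

(** * The two presentations and the isomorphism *)

Lemma quaternion_inversion_ext :
  is_inversion_ext prufer_z (@ext_nf _ quaternion_rel).
Proof.
have zz := prufer_z_sq.
have z_sq : quaternion_rel (gen None ++ gen None) (gen (Some prufer_z)).
  by apply: quaternion_rel_sqr; [exact: prufer_z_neq1 | rewrite expg2].
apply: presented_inversion_ext => //; first exact: prufer_mulC.
- move=> _ _ [c d|c|z z_neq1 zz1] p; rewrite /word_act /=.
  + exact: ext_act_mul.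
  + by apply: ext_act_conj => //; exact: prufer_mulC.
  (* The relation is imposed for every involution of C; uniqueness makes it [prufer_z]. *)
  + have [//|->] : z = 1 \/ z = prufer_z by apply: prufer_z_uniq.
    by apply: ext_act_sqr => //; exact: prufer_mulC.
- move=> c d; rewrite -word_class_cat.
  exact/esym/word_class_rel/quaternion_rel_mul.
- move=> c; rewrite -(word_class_rel (quaternion_rel_conj c)).
  by rewrite !word_class_cat word_class_inv mulVKg.
- by rewrite -word_class_cat; exact: word_class_rel.
Qed.

Lemma dihedral_inversion_ext :
  is_inversion_ext 1 (@ext_nf _ dihedral_rel).
Proof.
have yy :
    word_class dihedral_rel (gen None) * word_class dihedral_rel (gen None) = 1.
  by rewrite -word_class_cat (word_class_rel dihedral_rel_sqr).
apply: presented_inversion_ext => //; first exact: prufer_mulC; first exact: mulg1.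
- move=> _ _ [c d||c] p; rewrite /word_act /=.
  + exact: ext_act_mul.
  + rewrite ext_act_sqr ?mulg1 //; last exact: prufer_mulC.
    by case: p => d e; rewrite /ext_act /ext_mul /= mul1g mulg1.
  (* With [z = 1], [(None, true)] and [(None, false)] act in the same way. *)
  + by apply: ext_act_conj; [exact: prufer_mulC | exact: mulg1].
- move=> c d; rewrite -word_class_cat.
  exact/esym/word_class_rel/dihedral_rel_mul.
- move=> c; rewrite -(word_class_rel (dihedral_rel_conj c)).
  by rewrite !word_class_cat mulgA yy mul1g.
(* That the generator [Some 1] is trivial is not itself a relation; it follows from the table entry
   1 * 1 = 1 by cancellation. *)
- rewrite yy; apply/esym.
  apply: (@mulgI _ (word_class dihedral_rel (gen (Some 1)))).
  rewrite mulg1 -word_class_cat.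
  by rewrite (word_class_rel (dihedral_rel_mul 1 1)) mulg1.
Qed.

Theorem theorem4 :
  graph_isomorphic (Pow locally_quaternion) (Com locally_dihedral).
Proof.
have extQ := quaternion_inversion_ext; have extD := dihedral_inversion_ext.
have [bijQ _] := extQ; have [bijD _] := extD.
have [coord nfK coordK] := bijQ.
exists (@ext_nf _ dihedral_rel \o coord); split=> [|a b].
  by apply: bij_comp bijD _; exists (@ext_nf _ quaternion_rel).
rewrite -(coordK a) -(coordK b) /= !nfK /pow_adj /com_adj.
have := pow_coset_rel prufer_mulC prufer_z_sq prufer_comparable
  (coord a) (coord b) extQ.
have := com_coset_rel prufer_mulC prufer_z_sq prufer_z_uniq
  (coord a) (coord b) extD.
(* Both conditions become the same instance of [coset_rel]; distinctness transfers because the two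
   normal form maps are injective. *)
move=> -> ->.
by split=> -[ab ?]; split=> // E; apply: ab;
  [rewrite (bij_inj bijD E) | rewrite (bij_inj bijQ E)].
Qed.
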